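(* Let $(G,\gamma)$ be an edge-colored graph with $n$ vertices, $m$ edges, at least two colors, and $s$ colors that are each used exactly once in the graph $G$. If $n-2>m-s$, then $\operatorname{wld}(G)=n-1$.
   Context: An edge-colored graph $(G,\gamma)$ is a finite connected graph $G$ with a surjective function $\gamma:E(G)\to\mathcal{C}=\{c_1,\dots,c_\ell\}$ onto a finite set of colors (not necessarily a proper edge-coloring). For each color $c_i$ let $E_i(G)=\{e\in E(G):\gamma(e)=c_i\}$; the color $c_i$ is used exactly $t$ times if $|E_i(G)|=t$. For $W\subseteq E(G)$, let $G_i^W$ be the graph with vertex set $V(G)$ and edge set $W\cup E_i(G)$. The set $W$ is color-connecting if $G_i^W$ is connected for every color $c_i\in\mathcal{C}$. The wild number $\operatorname{wld}(G)$ is the minimum size of a color-connecting set. *)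

(* Defs.v *)
From mathcomp Require Import all_boot.
Set Implicit Arguments.
Unset Strict Implicit.
Unset Printing Implicit Defensive.

(* Finite undirected graphs, with parallel edges and loops permitted: an edge
   is an abstract object with a set of one (loop) or two endpoints.  Simple
   graphs are the case in which [ends] is injective with values of size 2. *)
Record graph := Graph {
  vertex : finType;
  edge : finType;
  ends : edge -> {set vertex};
  ends_card : forall e : edge, 0 < #|ends e| <= 2
}.

Definition adj (G : graph) (A : {set edge G}) : rel (vertex G) :=
  fun x y => [exists e in A, ends e == [set x; y]].

(* Connectedness of the graph (V(G), A); the empty graph is not connected. *)
Definition connected_by (G : graph) (A : {set edge G}) : bool :=
  (0 < #|vertex G|) && [forall x, forall y, connect (adj A) x y].

Record edge_colored_graph := EdgeColoredGraph {
  ugraph :> graph;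
  color : finType;
  gamma : edge ugraph -> color;
  ugraph_connected : connected_by [set: edge ugraph];
  gamma_surj : forall c : color, exists e : edge ugraph, gamma e = c
}.

Section WildNumber.
Variable G : edge_colored_graph.

Definition color_class (c : color G) : {set edge G} :=
  [set e | gamma e == c].

Definition used_exactly (t : nat) (c : color G) : bool := #|color_class c| == t.

Definition color_connecting (W : {set edge G}) : bool :=
  [forall c : color G, connected_by (W :|: color_class c)].

Lemma color_connectingT : color_connecting [set: edge G].
Proof. by apply/forallP => c; rewrite setTU ugraph_connected. Qed.

(* The default [set: edge G] of the arg min is admissible by
   [color_connectingT], so this is a genuine minimum: see [wild_numberP]. *)
Definition wild_number : nat :=
  #|[arg min_(W < [set: edge G] | color_connecting W) #|W|]|.

Lemma wild_numberP :
  (exists2 W, color_connecting W & #|W| = wild_number) /\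
  (forall W, color_connecting W -> wild_number <= #|W|).
Proof.
rewrite /wild_number; case: arg_minnP => [|W ccW minW].
  exact: color_connectingT.
by split; first exists W.
Qed.

End WildNumber.

(* Main.v *)
Require Import Defs.
From mathcomp Require Import all_boot all_order all_algebra.
From mathcomp Require Import zify.

(** A spanning tree is color-connecting, so the wild number is at most [n - 1].
Conversely let [W] be color-connecting with at most [n - 2] edges. Adding to
[W] the single edge [e] of a color used once gives a connected graph, which
has at least [n - 1] edges, so [e] is not in [W]. Hence [W] consists of edges
whose colors are repeated; there are at most [m - s < n - 2] of these, and
[W] plus one edge is too small to be connected. *)

Section SpanningTree.
Variable G : graph.
Implicit Types (A B : {set edge G}) (S : {set vertex G}).

Lemma adj_sym A : symmetric (adj A).
Proof. by move=> x y; apply: eq_existsb => e; rewrite setUC. Qed.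

Lemma connect_adjS A B : A \subset B ->
  subrel (connect (adj A)) (connect (adj B)).
Proof.
move=> sAB; apply: connect_sub => x y /existsP[e /andP[eA exy]].
by apply: connect1; apply/existsP; exists e; rewrite (subsetP sAB).
Qed.

Lemma connected_byS A B : A \subset B -> connected_by A -> connected_by B.
Proof.
move=> sAB /andP[n0 /forallP cA]; rewrite /connected_by n0 /=.
apply/forallP => x; apply/forallP => y.
exact: connect_adjS sAB _ _ (forallP (cA x) y).
Qed.

(** If no edge of [A] left [S], then [S] would be closed under adjacency, and no path could lead
    from [x] to [y]. *)
Lemma connected_by_boundary A S x y : connected_by A -> x \in S -> y \notin S ->
  exists u v, [/\ u \in S, v \notin S & adj A u v].
Proof.
move=> /andP[_ /forallP cA] xS yS.
case: (boolP [exists u in S, exists v, (v \notin S) && adj A u v]).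
  by case/exists_inP=> u uS /existsP[v /andP[vS uv]]; exists u, v.
move=> noE; suff clS: closed (adj A) (mem S).
  have := closed_connect clS (forallP (cA x) y).
  by rewrite /= xS (negPf yS).
have outS u v : adj A u v -> u \in S -> v \in S.
  move=> uv uS; apply: contraR noE => vS.
  by apply/exists_inP; exists u => //; apply/existsP; exists v; rewrite vS.
move=> u v uv; apply/idP/idP; first exact: outS uv.
by apply: outS; rewrite adj_sym.
Qed.

(** A tree is grown from [x0] by adding one boundary edge of [S] at a time. The clause that edges of
    [B] stay inside [S] is the invariant that makes each added edge new. *)
Lemma connected_by_subtree A (x0 : vertex G) k :
  connected_by A -> k < #|vertex G| ->
  exists S B, [/\ #|S| = k.+1, B \subset A, #|B| = k,
    forall e, e \in B -> ends e \subset S &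
    forall y, y \in S -> connect (adj B) x0 y].
Proof.
move=> cA; elim: k => [_|k IHk ltk].
  exists [set x0], set0; split; rewrite ?cards1 ?cards0 ?sub0set //.
    by move=> e; rewrite inE.
  by move=> y /set1P->.
have [S [B [cardS sBA cardB BS conB]]] := IHk (ltnW ltk).
have /set0Pn[x xS] : S != set0 by rewrite -card_gt0 cardS.
have /set0Pn[y] : ~: S != set0 by rewrite -card_gt0; have := cardsC S; lia.
rewrite inE => yS.
have [u [v [uS vS /existsP[e /andP[eA /eqP euv]]]]] :=
  connected_by_boundary _ _ _ _ cA xS yS.
have eB : e \notin B.
  apply: contra vS => /BS /subsetP; apply; rewrite euv !inE eqxx orbT //.
exists (v |: S), (e |: B); split.
- by rewrite cardsU1 vS cardS.
- by rewrite subUset sub1set eA.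
- by rewrite cardsU1 eB cardB.
- move=> f /setU1P[->|/BS fS]; last exact: subset_trans fS (subsetUr _ _).
  by rewrite euv subUset !sub1set !inE uS eqxx orbT.
have conS z : z \in S -> connect (adj (e |: B)) x0 z.
  by move=> /conB; apply: connect_adjS; apply: subsetUr.
move=> z /setU1P[->|]; last exact: conS.
apply: connect_trans (conS u uS) (connect1 _).
by apply/existsP; exists e; rewrite setU11 euv eqxx.
Qed.

Lemma connected_by_spanning_tree A : connected_by A ->
  exists B, [/\ B \subset A, connected_by B & #|B| = #|vertex G|.-1].
Proof.
move=> cA; have /andP[n0 _] := cA; have /card_gt0P[x0 _] := n0.
have ltn : #|vertex G|.-1 < #|vertex G| by rewrite prednK.
have [S [B [cardS sBA cardB _ conB]]] := connected_by_subtree _ x0 _ cA ltn.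
exists B; split=> //; rewrite /connected_by n0 /=.
have ST : S = [set: vertex G].
  by apply/eqP; rewrite eqEcard subsetT cardsT cardS prednK /=.
have conT y : connect (adj B) x0 y by apply: conB; rewrite ST inE.
apply/forallP => x; apply/forallP => y; apply: connect_trans (conT y).
by rewrite (sym_connect_sym (adj_sym B)).
Qed.

Lemma connected_by_card A : connected_by A -> #|vertex G| <= #|A|.+1.
Proof.
by move=> /connected_by_spanning_tree[B [/subset_leq_card sBA _ cardB]]; lia.
Qed.

End SpanningTree.

Section ColorsUsedOnce.
Variable G : edge_colored_graph.

Definition uniquely_colored : {set edge G} :=
  [set e | used_exactly 1 (gamma e)].

(** By surjectivity of [gamma], each color used once is the color of some edge, which then lies in
    [uniquely_colored]. *)
Lemma card_uniquely_colored :
  #|[set c : color G | used_exactly 1 c]| <= #|uniquely_colored|.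
Proof.
apply: leq_trans (leq_imset_card (@gamma G) (mem uniquely_colored)).
apply/subset_leq_card/subsetP => c; rewrite inE => c1.
by have [e ec] := gamma_surj c; apply/imsetP; exists e; rewrite ?inE ec.
Qed.

Lemma color_class_uniquely_colored e :
  e \in uniquely_colored -> color_class (gamma e) = [set e].
Proof.
rewrite inE => /cards1P[f Ef].
by have : e \in color_class (gamma e) by [rewrite inE]; rewrite Ef => /set1P->.
Qed.

(** The class of [gamma e] is just [e], so [e |: W] is connected; the boolean counts whether [e]
    enlarges [W]. *)
Lemma card_color_connecting (W : {set edge G}) e :
  color_connecting W -> e \in uniquely_colored ->
  #|vertex G| <= (#|W| + (e \notin W)).+1.
Proof.
move=> /forallP/(_ (gamma e)) cW /color_class_uniquely_colored Ee.
by have := connected_by_card _ _ cW; rewrite Ee setUC cardsU1 addnC.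
Qed.

End ColorsUsedOnce.

Theorem corollary6p6 (G : edge_colored_graph) (n m s : nat)
    (hn : #|vertex G| = n) (hm : #|edge G| = m)
    (hcolors : 1 < #|color G|)
    (hs : #|[set c : color G | used_exactly 1 c]| = s)
    (hnms : (n%:Z - 2%:Z > m%:Z - s%:Z)%R) :
  wild_number G = n - 1.
Proof.
have [[W ccW <-] minW] := wild_numberP G.
have [T [_ cT cardT]] := connected_by_spanning_tree _ _ (ugraph_connected G).
have WT : #|W| <= #|T|.
  by apply/minW/forallP => c; apply: connected_byS cT; apply: subsetUl.
have nm := connected_by_card _ _ (ugraph_connected G); rewrite cardsT in nm.
have sU := card_uniquely_colored G.
have UC := cardsC (uniquely_colored G).
(* The spanning tree [T] gives the upper bound; what remains is to refute [ltW]. *)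
have [|ltW] := leqP (n - 1) #|W|; first lia.
(* An edge of [W] with a unique color would make [W] itself connected, with fewer than [n - 1]
   edges. *)
have WU : W \subset ~: uniquely_colored G.
  apply/subsetP => e eW; rewrite inE; apply/negP => eU.
  by have := card_color_connecting _ _ _ ccW eU; rewrite eW; lia.
(* Connectedness of [G] gives [n <= m + 1], so the hypothesis forces [s > 0]. *)
have /card_gt0P[e eU] : 0 < #|uniquely_colored G| by lia.
have := card_color_connecting _ _ _ ccW eU.
(* By [WU], [W] has at most [m - s < n - 2] edges, whereas connectedness after adding [e] requires
   [n <= #|W| + 2]. *)
have := subset_leq_card WU; case: (e \notin W); lia.
Qed.
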